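(* Let $R$ be a Noetherian domain with fraction field $K$. Assume $R$ is not a field. Then $R$ is a discrete valuation ring (DVR) if and only if $x$ or $x^{-1}$ is in $R$ for each $x \in K^\times$.
   Context: All rings are commutative with unity. A discrete valuation of a field $K$ is a surjective group homomorphism $v\colon K^\times \to \mathbb{Z}$ (from the multiplicative group of $K$ to the additive group $\mathbb{Z}$) such that $v(x+y)\ge \min\{v(x),v(y)\}$ for all $x,y\in K^\times$ with $x+y\neq 0$; by convention $v(0)=\infty$. A discrete valuation ring (DVR) is any ring of the form $\mathcal{O}_v=\{x\in K \mid v(x)\ge 0\}$, where $K$ is a field and $v$ is a discrete valuation of $K$. *)

(* Defs.v *)
From mathcomp Require Import all_boot all_order all_algebra.

Set Implicit Arguments.
Unset Strict Implicit.
Unset Printing Implicit Defensive.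

Import Order.TTheory GRing.Theory Num.Theory.
Local Open Scope ring_scope.

(* Not ring_quotient's [idealr_closed], which only covers proper ideals given
   by boolean predicates. *)
Definition is_ideal (R : comPzRingType) (I : R -> Prop) : Prop :=
  [/\ I 0, (forall x y, I x -> I y -> I (x + y))
    & (forall a x, I x -> I (a * x))].

Definition generates (R : comPzRingType) (s : seq R) (I : R -> Prop) : Prop :=
  forall x, I x <->
    exists c : 'I_(size s) -> R, x = \sum_(i < size s) c i * s`_i.

Definition noetherian (R : comPzRingType) : Prop :=
  forall I : R -> Prop, is_ideal I -> exists s : seq R, generates s I.

(* A valuation is a map on the nonzero elements of L. It is encoded as a total
   function whose value at 0 is unconstrained and never used: the convention
   v(0) = oo is built into [valuation_ring], which always contains 0. *)
Record discrete_valuation (L : fieldType) (v : L -> int) : Prop := {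
  valM : forall x y, x != 0 -> y != 0 -> v (x * y) = v x + v y;
  val_surj : forall n : int, exists2 x, x != 0 & v x = n;
  valD : forall x y, x != 0 -> y != 0 -> x + y != 0 ->
    Num.min (v x) (v y) <= v (x + y) }.

Definition valuation_ring (L : fieldType) (v : L -> int) : {pred L} :=
  [pred x | (x == 0) || (0 <= v x)].

(* R is isomorphic to some O_v: an isomorphism from R onto the subring O_v of L
   is an injective ring morphism R -> L with image O_v. *)
Definition is_dvr (R : comPzRingType) : Prop :=
  exists (L : fieldType) (v : L -> int) (f : {rmorphism R -> L}),
    [/\ discrete_valuation v, injective f
      & forall y : L, y \in valuation_ring v <-> exists x : R, f x = y].

Definition in_base_ring (R : idomainType) (x : {fraction R}) : Prop :=
  exists r : R, x = FracField.tofrac r.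

(* Main.v *)
Require Import Defs.
From mathcomp Require Import all_boot all_order all_algebra.

Import Order.TTheory GRing.Theory Num.Theory.
Local Open Scope ring_scope.

(** From left to right, the image of a nonzero fraction [a / b] in the valued
    field has a valuation of some sign, so that [a / b] or [b / a] lands in the
    valuation ring, which is the image of [R].

    From right to left, the hypothesis says that divisibility is total on [R].
    Totality makes every finitely generated ideal principal and the nonunits an
    ideal; as [R] is Noetherian, the nonunits are the multiples of a single
    [p], which is nonzero since [R] is not a field
    ([nonunits_principal]). The main point is that every nonzero [a] is
    a power of [p] times a unit. For this, one shows that [a] divides some power
    of [p] by looking at the saturation [(a : p^oo)], the ideal of all [x] such
    that [a] divides some [p ^+ n * x]: it is principal and stable under
    division by [p], so its generator is not a multiple of [p] and
    hence is a unit ([nonunit_gen_expn_dvd]). A divisor of [p ^+ n] is then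
    a power of [p] up to a unit ([dvd_expn_nonunit_gen]). It follows that every
    nonzero fraction is [p ^ m * u] with [m] an integer and [u] a unit of [R].
    The exponent [m] is unique because [p] is not a unit, and it is the
    required valuation ([is_dvr_uniformizer]). *)

Local Notation "x %:F" := (FracField.tofrac x).

Definition divides (R : comPzRingType) (a b : R) : Prop :=
  exists c, b = c * a.

Arguments divides {R}.

Definition total_divisibility (R : comPzRingType) : Prop :=
  forall a b : R, divides a b \/ divides b a.

(** * Fractions *)

Lemma frac_numden (R : idomainType) (x : {fraction R}) :
  exists a b : R, b != 0 /\ x = a%:F / b%:F.
Proof.
elim/quotW: x => -[[a b] /= b_neq0]; exists a, b; split=> //.
apply: (canRL (mulfK _)); first by rewrite tofrac_eq0.
unlock FracField.tofrac; rewrite -[LHS]FracField.pi_mul.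
apply/eqmodP; rewrite /= FracField.equivfE /FracField.mulf /=.
by rewrite !numden_Ratio ?mulf_neq0 ?oner_eq0 //= !mulr1 mulrC.
Qed.

Lemma frac_in_base_ring (R : idomainType) (a b : R) :
  b != 0 -> divides b a -> in_base_ring (a%:F / b%:F).
Proof.
move=> b_neq0 [c ->]; exists c.
by rewrite rmorphM mulfK // tofrac_eq0.
Qed.

Lemma total_divisibility_frac (R : idomainType) :
  (forall x : {fraction R}, x != 0 ->
     in_base_ring x \/ in_base_ring x^-1) ->
  total_divisibility R.
Proof.
move=> total a b.
have [->|a_neq0] := eqVneq a 0; first by right; exists 0; rewrite mul0r.
have [->|b_neq0] := eqVneq b 0; first by left; exists 0; rewrite mul0r.
have aF_neq0 : a%:F != 0 by rewrite tofrac_eq0.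
have bF_neq0 : b%:F != 0 by rewrite tofrac_eq0.
have [|[c]|[c]] := total (a%:F / b%:F).
- by rewrite mulf_neq0 ?invr_eq0.
- move/(canRL (divfK bF_neq0)); rewrite -rmorphM => /eqP.
  by rewrite tofrac_eq => /eqP ->; right; exists c.
- rewrite invf_div => /(canRL (divfK aF_neq0)); rewrite -rmorphM => /eqP.
  by rewrite tofrac_eq => /eqP ->; left; exists c.
Qed.

(** * Valuation rings have total divisibility *)

(** The sign of [v (f a) - v (f b)] decides which of [a] and [b] divides the
    other. *)
Lemma is_dvr_total_divisibility (R : comPzRingType) :
  is_dvr R -> total_divisibility R.
Proof.
case=> L [v [f [[vM _ _] f_inj f_im]]] a b.
have dvd (c d : R) : f d != 0 -> v (f d) <= v (f c) -> divides d c.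
  move=> fd_neq0 le_v.
  suff /f_im[r fr] : f c / f d \in valuation_ring v.
    by exists r; apply: f_inj; rewrite rmorphM fr divfK.
  rewrite inE; have [//|q_neq0 /=] := eqVneq (f c / f d) 0.
  by move: le_v; rewrite -{1}(divfK fd_neq0 (f c)) [v (_ / _ * _)]vM // lerDr.
have f0 c : f c = 0 -> c = 0 by move=> fc0; apply: f_inj; rewrite fc0 rmorph0.
have [/f0->|fa_neq0] := eqVneq (f a) 0.
  by right; exists 0; rewrite mul0r.
have [/f0->|fb_neq0] := eqVneq (f b) 0.
  by left; exists 0; rewrite mul0r.
by case: (leP (v (f a)) (v (f b))) => [|/ltW] /dvd; auto.
Qed.

(** * Ideals of a ring with total divisibility *)

(** Among the finitely many generators, one divides all the others. *)
Lemma noetherian_principal (R : comPzRingType) (I : R -> Prop) :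
    noetherian R -> total_divisibility R -> is_ideal I ->
  exists2 d, I d & forall x, I x -> divides d x.
Proof.
move=> noeth total idI; have [s gen_s] := noeth I idI.
have [I0 _ _] := idI.
have Is x : x \in s -> I x.
  move=> /(nthP 0)[i lt_i <-]; apply/gen_s.
  exists (fun j => (j == Ordinal lt_i)%:R).
  rewrite (bigD1 (Ordinal lt_i)) //= eqxx mul1r big1 ?addr0 // => j /negPf->.
  by rewrite mul0r.
have [d Id dvd_s] : exists2 d, I d & forall x, x \in s -> divides d x.
  elim: s Is {gen_s} => [|y s IHs] Is; first by exists 0.
  have [|d Id dvd_s] := IHs.
    by move=> x s_x; apply: Is; rewrite inE s_x orbT.
  have [[c Dy]|[c Dd]] := total d y.
    by exists d => // x; rewrite inE => /predU1P[->|/dvd_s//]; exists c.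
  exists y; first by apply: Is; rewrite inE eqxx.
  move=> x; rewrite inE => /predU1P[->|/dvd_s[e ->]].
    by exists 1; rewrite mul1r.
  by exists (e * c); rewrite Dd mulrA.
exists d => // x /gen_s[c ->].
elim/big_ind: _ => [|_ _ [e ->] [g ->]|i _].
- by exists 0; rewrite mul0r.
- by exists (e + g); rewrite mulrDl.
- have [e ->] := dvd_s _ (mem_nth 0 (ltn_ord i)).
  by exists (c i * e); rewrite mulrA.
Qed.

(** A sum [x + y] is a multiple of [x] or of [y], whichever divides the other;
    a multiple of a nonunit is a nonunit. *)
Lemma nonunits_ideal (R : comUnitRingType) :
  (0 : R) \isn't a GRing.unit -> total_divisibility R ->
  is_ideal (fun x : R => x \isn't a GRing.unit).
Proof.
move=> nu0 total; split=> // [x y nux nuy|a x nux]; last first.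
  by rewrite unitrM negb_and nux orbT.
have [[c ->]|[c ->]] := total x y.
  by rewrite -{1}[x]mul1r -mulrDl unitrM negb_and nux orbT.
by rewrite -{2}[y]mul1r -mulrDl unitrM negb_and nuy orbT.
Qed.

Definition nonunit_gen (R : unitRingType) (p : R) : Prop :=
  p \isn't a GRing.unit /\
  forall x, x \isn't a GRing.unit -> exists c, x = c * p.

Arguments nonunit_gen {R}.

Lemma nonunits_principal (R : idomainType) :
    noetherian R -> ~ GRing.field_axiom R -> total_divisibility R ->
  exists2 p : R, p != 0 & nonunit_gen p.
Proof.
move=> noeth not_field total.
have nu0 : (0 : R) \isn't a GRing.unit by rewrite unitr0.
have [p nup gen_p] :=
  noetherian_principal _ _ noeth total (nonunits_ideal _ nu0 total).
exists p => //; apply/negP => /eqP p0; apply: not_field => x.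
by apply: contraR => /gen_p[c ->]; rewrite p0 mulr0.
Qed.

(** * Factorization into a power of the uniformizer and a unit *)

(** If [d] generates the saturation [(a : p^oo)] and [d = e * p], then [e] also
    lies in it, so [d] divides [e] and [p] is a unit. Hence the
    generator is a unit and the saturation contains [1]. *)
Lemma nonunit_gen_expn_dvd (R : idomainType) (p a : R) :
    noetherian R -> total_divisibility R -> nonunit_gen p -> a != 0 ->
  exists n, divides a (p ^+ n).
Proof.
move=> noeth total [nup gen_p] a_neq0.
pose sat x := exists n, divides a (p ^+ n * x).
have sat_ideal : is_ideal sat.
  split=> [|x y [m [c Dx]] [n [d Dy]]|b x [n [c Dx]]].
  - by exists 0%N, 0; rewrite mulr0 mul0r.
  - exists (m + n)%N, (p ^+ n * c + p ^+ m * d).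
    by rewrite mulrDl -!mulrA -Dx -Dy mulrDr exprD !mulrA [p ^+ n * _]mulrC.
  - by exists n, (b * c); rewrite mulrCA Dx mulrA.
have [d [n [c Dd]] gen_d] :=
  noetherian_principal _ _ noeth total sat_ideal.
have d_neq0 : d != 0.
  apply: contraNneq a_neq0 => d0.
  have [|e ->] := gen_d a; first by exists 0%N, 1.
  by rewrite d0 mulr0.
have [ud|/gen_p[e De]] := boolP (d \is a GRing.unit).
  by exists n, (d^-1 * c); rewrite -mulrA -Dd mulrCA mulVr ?mulr1.
have [|g Dg] := gen_d e.
  by exists n.+1, c; rewrite exprSr -mulrA [p * e]mulrC -De.
case/negP: nup; apply/unitrPr; exists g; apply: (mulfI d_neq0).
by rewrite mulr1 mulrC -mulrA -Dg mulrC -De.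
Qed.

(** If the cofactor of [a] in [p ^+ n] is a nonunit, it is a multiple of [p],
    and cancelling [p] shows that [a] already divides [p ^+ n.-1]. *)
Lemma dvd_expn_nonunit_gen (R : idomainType) (p a : R) (n : nat) :
    p != 0 -> nonunit_gen p -> divides a (p ^+ n) ->
  exists m u, u \is a GRing.unit /\ a = p ^+ m * u.
Proof.
move=> p_neq0 [nup gen_p] [c Dc].
have [uc|nuc] := boolP (c \is a GRing.unit).
  by exists n, c^-1; rewrite unitrV uc Dc mulrAC divrr ?mul1r.
elim: n c Dc nuc => [|n IHn] c Dc nuc.
  case/negP: nuc; apply/unitrPr; exists a; by rewrite -Dc.
have [d Dd] := gen_p c nuc.
have Da : p ^+ n = d * a.
  by apply: (mulIf p_neq0); rewrite -exprSr Dc Dd mulrAC.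
have [ud|nud] := boolP (d \is a GRing.unit); last exact: IHn Da nud.
by exists n, d^-1; rewrite unitrV ud Da mulrAC divrr ?mul1r.
Qed.

(** * The valuation of a uniformizer *)

(** The uniqueness of the exponent comes down to this: were [m] negative,
    [p] would divide a unit. *)
Lemma expz_unit_in_base_ring (R : idomainType) (p u : R) (m : int) :
    p != 0 -> p \isn't a GRing.unit -> u \is a GRing.unit ->
  in_base_ring (p%:F ^ m * u%:F) <-> 0 <= m.
Proof.
move=> p_neq0 nup uu; split=> [[r]|]; last first.
  by case: m => // n _; exists (p ^+ n * u); rewrite rmorphM rmorphXn.
case: m => // n; rewrite NegzE -invr_expz => /(canRL (mulVKf _)).
rewrite -exprnP -rmorphXn -rmorphM tofrac_eq0 expf_neq0 // => /(_ isT)/eqP.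
rewrite tofrac_eq => /eqP Du; move: uu.
by rewrite Du exprS -mulrA unitrM (negPf nup).
Qed.

(** The valuation sends [x] to the exponent of [p] in [x]. Its ultrametric
    inequality follows from multiplicativity: if [v x <= v y], then
    [y / x], and so [1 + y / x], has nonnegative valuation. *)
Lemma is_dvr_uniformizer (R : idomainType) (p : R) :
    p != 0 -> p \isn't a GRing.unit ->
    (forall a, a != 0 -> exists n u, u \is a GRing.unit /\ a = p ^+ n * u) ->
  is_dvr R.
Proof.
move=> p_neq0 nup factor.
have pF_neq0 : p%:F != 0 by rewrite tofrac_eq0.
have uF_neq0 (u : R) : u \is a GRing.unit -> u%:F != 0.
  by move=> uu; rewrite tofrac_eq0; apply: contraTneq uu => ->; rewrite unitr0.
(* The implication makes the choice of an exponent available for every [x], so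
   that [v] can be a total function; its value at [0] is arbitrary. *)
have ex_val (x : {fraction R}) : exists mu : int * R,
    (x != 0) ==> (mu.2 \is a GRing.unit) && (x == p%:F ^ mu.1 * mu.2%:F).
  have [->|] := eqVneq x 0; first by exists (0, 0).
  have [a [b [b_neq0 ->]]] := frac_numden R x.
  rewrite mulf_eq0 tofrac_eq0 => /norP[/factor[n [u [uu ->]]] _].
  have [k [w [uw ->]]] := factor b b_neq0.
  exists (n%:Z - k%:Z, u / w); rewrite /= unitrM unitrV uu uw /=.
  apply/eqP; rewrite !rmorphM !rmorphXn expfzDr // -invr_expz invfM.
  rewrite -!exprnP -!mulrA; congr (_ * _); rewrite mulrCA; congr (_ * (_ * _)).
  apply: (mulfI (uF_neq0 w uw)).
  by rewrite divff ?uF_neq0 // -rmorphM divrr ?rmorph1.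
pose v x : int := (xchoose (ex_val x)).1.
have valE (x : {fraction R}) : x != 0 ->
    exists2 u, u \is a GRing.unit & x = p%:F ^ v x * u%:F.
  move=> x_neq0; have /implyP/(_ x_neq0)/andP[uu /eqP Dx] :=
    xchooseP (ex_val x).
  by exists (xchoose (ex_val x)).2.
have val_ge0 (x : {fraction R}) : x != 0 -> in_base_ring x <-> 0 <= v x.
  by move=> /valE[u uu Dx]; rewrite {1}Dx; exact: expz_unit_in_base_ring.
have le_exp (m n : int) (u w : R) : u \is a GRing.unit -> w \is a GRing.unit ->
    p%:F ^ m * u%:F = p%:F ^ n * w%:F -> n <= m.
  move=> uu uw E; rewrite -subr_ge0.
  apply/(expz_unit_in_base_ring _ _ _ _ p_neq0 nup uu); exists w.
  by rewrite addrC expfzDr // -mulrA E mulrA -expfzDr // addNr expr0z mul1r.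
have val_expz (m : int) u : u \is a GRing.unit -> v (p%:F ^ m * u%:F) = m.
  move=> uu; have [|w uw E] := valE (p%:F ^ m * u%:F).
    exact: mulf_neq0 (expfz_neq0 m pF_neq0) (uF_neq0 u uu).
  apply: le_anti; apply/andP; split.
    exact: le_exp E.
  exact: le_exp (esym E).
have vM x y : x != 0 -> y != 0 -> v (x * y) = v x + v y.
  move=> /valE[u uu Dx] /valE[w uw Dy].
  rewrite {1}Dx {1}Dy mulrACA -expfzDr // -rmorphM val_expz //.
  by rewrite unitrM uu uw.
have vD_le x y : x != 0 -> y != 0 -> x + y != 0 ->
    v x <= v y -> v x <= v (x + y).
  move=> x_neq0 y_neq0 xy_neq0 le_v.
  have Dxy : x + y = x * (1 + y / x) by rewrite mulrDr mulr1 mulrC divfK.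
  have q_neq0 : 1 + y / x != 0.
    by apply: contraNneq xy_neq0; rewrite Dxy => ->; rewrite mulr0.
  rewrite Dxy vM // lerDl; apply/(val_ge0 _ q_neq0).
  have [|_] := val_ge0 (y / x); first by rewrite mulf_neq0 ?invr_eq0.
  case.
    move: le_v; rewrite -{1}(divfK x_neq0 y) [v (_ / _ * _)]vM //.
      by rewrite lerDr.
    by rewrite mulf_neq0 ?invr_eq0.
  by move=> r ->; exists (1 + r); rewrite rmorphD rmorph1.
exists {fraction R}, v, (@FracField.tofrac R); split.
- split=> // [m|x y x_neq0 y_neq0 xy_neq0].
    exists (p%:F ^ m * 1%:F); last by rewrite val_expz ?unitr1.
    exact: mulf_neq0 (expfz_neq0 m pF_neq0) (uF_neq0 1 (unitr1 R)).
  rewrite ge_min.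
  case: (leP (v x) (v y)) => [le_v|/ltW le_v].
    by rewrite vD_le.
  by rewrite [x + y]addrC vD_le ?orbT // addrC.
- by move=> a b /eqP; rewrite tofrac_eq => /eqP.
move=> y; rewrite inE; have [->|y_neq0 /=] := eqVneq y 0.
  by split=> // _; exists 0; rewrite rmorph0.
have [y_in y_ge0] := val_ge0 y y_neq0.
by split=> [/y_ge0[r ->]|[r Dy]]; [exists r | apply: y_in; exists r].
Qed.

Theorem proposition15 (R : idomainType)
    (R_noetherian : noetherian R) (R_not_field : ~ GRing.field_axiom R) :
  is_dvr R <->
  (forall x : {fraction R}, x != 0 -> in_base_ring x \/ in_base_ring x^-1).
Proof.
split=> [/is_dvr_total_divisibility total x|/total_divisibility_frac total].
  have [a [b [b_neq0 ->]]] := frac_numden R x.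
  rewrite mulf_eq0 tofrac_eq0 => /norP[a_neq0 _]; rewrite invf_div.
  by case: (total a b) => dvd_ab; [right|left]; apply: frac_in_base_ring.
have [p p_neq0 gen_p] := nonunits_principal R R_noetherian R_not_field total.
apply: (is_dvr_uniformizer R p p_neq0 gen_p.1) => a a_neq0.
have [n a_dvd] := nonunit_gen_expn_dvd R p a R_noetherian total gen_p a_neq0.
exact: dvd_expn_nonunit_gen p_neq0 gen_p a_dvd.
Qed.
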